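(* The function $d(G,H) := \Vert G\Vert^2 + \Vert H\Vert^2 - 2\,G.H$ is a metric on the set of isomorphism classes of simple graphs on $n$ vertices; that is, for all simple $n$-vertex graphs $G,H,G_1,G_2$: $d(G,H)\ge 0$; $d(G,H)=0$ if and only if $G\cong H$; and $d(G_1,G_2)\le d(G_1,H)+d(G_2,H)$.
   Context: For a simple graph $G$ on vertices $v_1,\dots,v_n$, $A_G$ is the $n\times n$ matrix with zero diagonal and, for $i\ne j$, $(A_G)_{ij}=+1$ if $v_i,v_j$ are adjacent and $-1$ otherwise. The dot product is $G.H := \max_P \operatorname{tr}(A_G P A_H P^T)$, the maximum over all $n\times n$ permutation matrices $P$, and $\Vert G\Vert = \sqrt{G.G}$. *)

(* Defs.v *)
From HB Require Import structures.
From mathcomp Require Import all_boot all_order all_algebra all_fingroup.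
Set Implicit Arguments.
Unset Strict Implicit.
Unset Printing Implicit Defensive.
Import Order.TTheory GRing.Theory Num.Theory.
Local Open Scope ring_scope.

Record sgraph (n : nat) : Type := SGraph {
  adj : rel 'I_n;
  adj_sym : symmetric adj;
  adj_irr : irreflexive adj
}.

Definition graph_iso (n : nat) (G H : sgraph n) : Prop :=
  exists2 f : 'I_n -> 'I_n, bijective f &
    forall i j : 'I_n, adj G i j = adj H (f i) (f j).

Definition adjmx (R : rcfType) (n : nat) (G : sgraph n) : 'M[R]_n :=
  \matrix_(i, j) if i == j then 0 else if adj G i j then 1 else -1.

Definition perm_trace (R : rcfType) (n : nat) (G H : sgraph n) (P : 'M[R]_n) : R :=
  \tr (adjmx R G *m P *m adjmx R H *m P^T).

(* The default value of the iterated maximum is the term of the identity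
   permutation, so it belongs to the set being maximised and does not affect
   the maximum. *)
Definition graph_dot (R : rcfType) (n : nat) (G H : sgraph n) : R :=
  \big[Num.max/perm_trace G H (perm_mx 1%g)]_(s : 'S_n)
    perm_trace G H (perm_mx s).

Definition graph_norm (R : rcfType) (n : nat) (G : sgraph n) : R :=
  Num.sqrt (graph_dot R G G).

Definition graph_dist (R : rcfType) (n : nat) (G H : sgraph n) : R :=
  graph_norm R G ^+ 2 + graph_norm R H ^+ 2 - 2 * graph_dot R G H.

(* Main.v *)
Require Import Defs.
From HB Require Import structures.
From mathcomp Require Import all_boot all_order all_algebra all_fingroup.
From mathcomp Require Import ring lra.
Set Implicit Arguments.
Unset Strict Implicit.
Unset Printing Implicit Defensive.
Import Order.TTheory GRing.Theory Num.Theory.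
Local Open Scope ring_scope.

(** Since every off-diagonal entry of [A_G] is [±1], [‖G‖²] is the number
    [n(n-1)] of ordered pairs of distinct vertices, and expanding squares shows
    that [d(G,H)] is the minimum over permutations [s] of
    [sum_(i,j) (A_G(i,j) - A_H(s i,s j))²]. Each of these summands is [0] or [4],
    according to whether two signs agree, so it satisfies the triangle inequality entrywise, which survives the
    minimum by composing permutations. *)

Lemma adjmx_sqr (R : rcfType) (n : nat) (G : sgraph n) (i j : 'I_n) :
  adjmx R G i j ^+ 2 = (i != j)%:R.
Proof.
rewrite mxE; case: eqP => _; first by rewrite expr0n.
by case: ifP; rewrite ?sqrrN expr1n.
Qed.

Lemma adjmx_sym (R : rcfType) (n : nat) (G : sgraph n) (i j : 'I_n) :
  adjmx R G i j = adjmx R G j i.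
Proof. by rewrite !mxE eq_sym adj_sym. Qed.

(** Squared differences of arbitrary reals violate this inequality; it holds here because
    off-diagonal entries are signs: if two of them differ, the third differs from one of the two. *)
Lemma adjmx_triangle (R : rcfType) (n : nat) (G1 G2 H : sgraph n)
    (s t : 'S_n) (i j : 'I_n) :
  (adjmx R G1 i j - adjmx R G2 (s i) (s j)) ^+ 2 <=
  (adjmx R G1 i j - adjmx R H (t i) (t j)) ^+ 2 +
  (adjmx R G2 (s i) (s j) - adjmx R H (t i) (t j)) ^+ 2.
Proof.
rewrite !mxE !(inj_eq perm_inj); case: eqP => _.
  by rewrite subrr expr0n addr0.
by do 3![case: ifP => _]; lra.
Qed.

Lemma perm_traceE (R : rcfType) (n : nat) (G H : sgraph n) (s : 'S_n) :
  perm_trace G H (perm_mx s) =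
  \sum_i \sum_j adjmx R G i j * adjmx R H (s i) (s j).
Proof.
rewrite /perm_trace -!mulmxA tr_perm_mx -col_permE -row_permE.
apply: eq_bigr => i _; rewrite mxE; apply: eq_bigr => j _.
(* The matrix product yields the entry of [A_H] at [(s j, s i)]; symmetry puts the indices in
   order. *)
by rewrite [adjmx R H _ _]adjmx_sym; congr (_ * _); rewrite !mxE.
Qed.

(** Four times the number of ordered pairs of distinct vertices whose adjacency is not preserved by
    [s]. *)
Definition mismatch (R : rcfType) (n : nat) (G H : sgraph n) (s : 'S_n) : R :=
  \sum_i \sum_j (adjmx R G i j - adjmx R H (s i) (s j)) ^+ 2.

Lemma mismatch_ge0 (R : rcfType) (n : nat) (G H : sgraph n) (s : 'S_n) :
  0 <= mismatch R G H s.
Proof. by do 2![apply: sumr_ge0 => ? _]; exact: sqr_ge0. Qed.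

(** The double sum does not depend on [s], so maximising the trace is minimising the mismatch. *)
Lemma mismatchE (R : rcfType) (n : nat) (G H : sgraph n) (s : 'S_n) :
  mismatch R G H s =
  2 * (\sum_(i < n) \sum_(j < n) (i != j)%:R - perm_trace G H (perm_mx s)).
Proof.
rewrite perm_traceE -sumrB mulr_sumr; apply: eq_bigr => i _.
rewrite -sumrB mulr_sumr; apply: eq_bigr => j _.
by rewrite sqrrB !adjmx_sqr (inj_eq perm_inj) -mulr_natl; ring.
Qed.

Lemma mismatch_triangle (R : rcfType) (n : nat) (G1 G2 H : sgraph n)
    (s t : 'S_n) :
  mismatch R G1 G2 (s * t^-1)%g <= mismatch R G1 H s + mismatch R G2 H t.
Proof.
set u := (s * t^-1)%g.
(* Since [t (u i) = s i], reindexing by [u] makes both sums on the right pass through the same pair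
   [(s i, s j)] of [H]. *)
have -> : mismatch R G2 H t =
    \sum_i \sum_j (adjmx R G2 (u i) (u j) - adjmx R H (s i) (s j)) ^+ 2.
  rewrite /mismatch (reindex_perm u); apply: eq_bigr => i _.
  rewrite (reindex_perm u); apply: eq_bigr => j _.
  by rewrite /u !permM !permKV.
rewrite -big_split; apply: ler_sum => i _.
by rewrite -big_split; apply: ler_sum => j _; exact: adjmx_triangle.
Qed.

Lemma mismatch_eq0 (R : rcfType) (n : nat) (G H : sgraph n) (s : 'S_n) :
  mismatch R G H s = 0 <-> forall i j, adj G i j = adj H (s i) (s j).
Proof.
split=> [e0 i j | GH].
  have : (adjmx R G i j - adjmx R H (s i) (s j)) ^+ 2 = 0.
    have sum0 : \sum_k (adjmx R G i k - adjmx R H (s i) (s k)) ^+ 2 = 0.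
      apply: (psumr_eq0P _ e0) => // k _.
      by apply: sumr_ge0 => ? _; exact: sqr_ge0.
    by apply: (psumr_eq0P _ sum0) => // k _; exact: sqr_ge0.
  move/eqP; rewrite sqrf_eq0 subr_eq0 !mxE (inj_eq perm_inj).
  (* Diagonal entries are [0] by definition and carry no information on [adj]; irreflexivity settles
     this case. *)
  case: (i =P j) => [-> | _]; first by rewrite !adj_irr.
  by do 2![case: ifP => _] => // /eqP; lra.
do 2![apply: big1 => ? _].
by rewrite !mxE (inj_eq perm_inj) -GH subrr expr0n.
Qed.

Lemma graph_dot_max (R : rcfType) (n : nat) (G H : sgraph n) (s : 'S_n) :
  perm_trace G H (perm_mx s) <= graph_dot R G H.
Proof. exact: (le_bigmax _ (fun t : 'S_n => perm_trace G H (perm_mx t))). Qed.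

Lemma graph_dot_attained (R : rcfType) (n : nat) (G H : sgraph n) :
  exists s : 'S_n, graph_dot R G H = perm_trace G H (perm_mx s).
Proof.
rewrite /graph_dot; elim/big_ind: _ => [|x y [s ->] [t ->]|s _].
- by exists 1%g.
- by rewrite maxEle; case: ifP => _; [exists t | exists s].
- by exists s.
Qed.

(** The identity attains this value, and nonnegativity of the mismatch of [G] with itself rules out
    a larger trace. *)
Lemma graph_norm_sqr (R : rcfType) (n : nat) (G : sgraph n) :
  graph_norm R G ^+ 2 = \sum_(i < n) \sum_(j < n) (i != j)%:R.
Proof.
have trace1 : perm_trace G G (perm_mx 1%g) =
    \sum_(i < n) \sum_(j < n) (i != j)%:R :> R.
  rewrite perm_traceE; do 2![apply: eq_bigr => ? _].
  by rewrite !perm1 -expr2 adjmx_sqr.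
have -> : graph_norm R G ^+ 2 = graph_dot R G G.
  (* Squaring undoes [Num.sqrt] only on nonnegative values; the identity term gives the lower
     bound. *)
  apply/sqr_sqrtr/(le_trans _ (graph_dot_max R G G 1%g)).
  by rewrite trace1; do 2![apply: sumr_ge0 => ? _]; exact: ler0n.
apply/eqP; rewrite eq_le -{2}trace1 graph_dot_max andbT.
have [s ->] := graph_dot_attained R G G.
by rewrite -subr_ge0 -(pmulr_rge0 _ (ltr0n R 2)) -mismatchE mismatch_ge0.
Qed.

Lemma graph_dist_le (R : rcfType) (n : nat) (G H : sgraph n) (s : 'S_n) :
  graph_dist R G H <= mismatch R G H s.
Proof.
rewrite /graph_dist !graph_norm_sqr mismatchE.
by have := graph_dot_max R G H s; lra.
Qed.

Lemma graph_dist_attained (R : rcfType) (n : nat) (G H : sgraph n) :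
  exists s : 'S_n, graph_dist R G H = mismatch R G H s.
Proof.
have [s dotE] := graph_dot_attained R G H; exists s.
by rewrite /graph_dist !graph_norm_sqr mismatchE dotE; ring.
Qed.

Lemma graph_dist_ge0 (R : rcfType) (n : nat) (G H : sgraph n) :
  0 <= graph_dist R G H.
Proof. by have [s ->] := graph_dist_attained R G H; exact: mismatch_ge0. Qed.

Lemma graph_dist_triangle (R : rcfType) (n : nat) (G1 G2 H : sgraph n) :
  graph_dist R G1 G2 <= graph_dist R G1 H + graph_dist R G2 H.
Proof.
have [s ->] := graph_dist_attained R G1 H.
have [t ->] := graph_dist_attained R G2 H.
exact: le_trans (graph_dist_le R G1 G2 _) (mismatch_triangle R G1 G2 H s t).
Qed.

Lemma graph_dist_eq0 (R : rcfType) (n : nat) (G H : sgraph n) :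
  graph_dist R G H = 0 <-> graph_iso G H.
Proof.
split=> [|[f /bij_inj f_inj GH]].
  have [s ->] := graph_dist_attained R G H => /mismatch_eq0 GH.
  by exists s => //; exists (s^-1)%g; [exact: permK | exact: permKV].
apply/eqP; rewrite eq_le graph_dist_ge0 andbT.
apply: le_trans (graph_dist_le R G H (perm f_inj)) _.
rewrite (_ : mismatch _ _ _ _ = 0) //.
by apply/mismatch_eq0 => i j; rewrite !permE.
Qed.

(** The triangle inequality has its third graph as second argument in both terms; taking it equal to
    [G], then to [H], gives the two inequalities. *)
Lemma graph_distC (R : rcfType) (n : nat) (G H : sgraph n) :
  graph_dist R G H = graph_dist R H G.
Proof.
have dist0 (K : sgraph n) : graph_dist R K K = 0.
  by apply/graph_dist_eq0; exists id => //; exists id.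
by apply/eqP; rewrite eq_le -[leRHS]add0r -{1}(dist0 G) graph_dist_triangle
  -[leRHS]add0r -(dist0 H) graph_dist_triangle.
Qed.

Theorem theorem1 (R : rcfType) (n : nat) :
  (forall G G' H H' : sgraph n, graph_iso G G' -> graph_iso H H' ->
     graph_dist R G H = graph_dist R G' H') /\
  (forall G H : sgraph n, 0 <= graph_dist R G H) /\
  (forall G H : sgraph n, graph_dist R G H = 0 <-> graph_iso G H) /\
  (forall G H : sgraph n, graph_dist R G H = graph_dist R H G) /\
  (forall G1 G2 H : sgraph n,
     graph_dist R G1 G2 <= graph_dist R G1 H + graph_dist R G2 H).
Proof.
(* Two triangle inequalities, through [G'] and then [H'], replace each graph by one at distance
   [0]. *)
have dist_le (G G' H H' : sgraph n) : graph_dist R G G' = 0 ->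
    graph_dist R H H' = 0 -> graph_dist R G H <= graph_dist R G' H'.
  move=> GG' HH'; have := graph_dist_triangle R G H G'.
  have := graph_dist_triangle R H G' H'.
  by rewrite GG' HH' !add0r => HG' /le_trans; apply.
split.
  move=> G G' H H' /(graph_dist_eq0 R) GG' /(graph_dist_eq0 R) HH'.
  by apply/eqP; rewrite eq_le !dist_le // graph_distC.
split; first exact: graph_dist_ge0.
split; first exact: graph_dist_eq0.
split; first exact: graph_distC.
exact: graph_dist_triangle.
Qed.
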